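(* Let $a_1(u),a_2(v):\mathbb{R}\to\mathbb{H}^3_1$ be two regular curves, with $a_1(0)=1=a_2(0)$, satisfying: (i) $\langle a_i',a_ij\rangle=0$ for $i=1,2$. (ii) $u$ and $v$ are the asymptotic parameters of $a_1$ and $a_2$, respectively. (iii) The functions $\omega_1=\omega^{a_1}$ and $\omega_2=\pi-\omega^{a_2}$ verify $\sin(\omega_1(u)+\omega_2(v))>0$ for all $(u,v)\in\mathbb{R}^2$. (iv) The map $(u,v)\mapsto(x(u,v),y(u,v))$ given by $$x(u,v)=\int_0^u\cos\omega_1+\int_0^v\cos\omega_2,\qquad y(u,v)=\int_0^u\sin\omega_1-\int_0^v\sin\omega_2$$ is a global diffeomorphism of $\mathbb{R}^2$. Then $f:\mathbb{R}^2\to\mathbb{H}^3_1$ defined by $f(u,v)=a_1(u)\,\overline{a_2(v)}$ describes an isometric immersion of $\mathbb{L}^2$ into $\mathbb{H}^3_1$ (i.e. $f$ is an immersion and $\mathbb{R}^2$ with the induced metric is isometric to $\mathbb{L}^2$), and $(u,v)$ are global characteristic parameters of $f$ with angle functions $\omega_1,\omega_2$ (suitably normalized by adding constants in $2\pi\mathbb{Z}$).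
   Context: $\mathbb{L}^2$ is $\mathbb{R}^2$ with the metric $-dx^2+dy^2$. $\mathbb{R}^4_2$ is $\mathbb{R}^4$ with the metric $\langle\ ,\ \rangle=-dx_0^2-dx_1^2+dx_2^2+dx_3^2$, identified with the associative algebra $\{x_0+x_1i+x_2j+x_3k\}$ with unit $1$ and products $i^2=-1$, $j^2=k^2=1$, $ij=k$, $ji=-k$, $ik=-j$, $ki=j$, $jk=-i$, $kj=i$. Conjugation is $\overline{x_0+x_1i+x_2j+x_3k}=x_0-x_1i-x_2j-x_3k$. The anti-de Sitter space is $\mathbb{H}^3_1=\{z\in\mathbb{R}^4_2:\langle z,z\rangle=-1\}=\{z: z\bar z=1\}$, a Lie group. For a regular curve $a(s)$ in $\mathbb{H}^3_1$ with $\langle a',aj\rangle=0$ one has $\bar a a'=\lambda i+\mu k$ with $\lambda,\mu$ smooth; $s$ is the asymptotic parameter of $a$ if $\lambda^2+\mu^2=1$, and then $\overline{a(s)}a'(s)=\cos(\omega^a(s))\,i+\sin(\omega^a(s))\,k$ for some smooth $\omega^a$, unique up to adding a constant in $2\pi\mathbb{Z}$. $(u,v)\in\mathbb{R}^2$ are global characteristic parameters of an immersion $f(u,v)$ into $\mathbb{H}^3_1$, with angle functions $\omega_1(u),\omega_2(v)$, if $\omega_1(u)+\omega_2(v)\in(0,\pi)$ for all $(u,v)$ and, for a unit normal $N$ of $f$ in $\mathbb{H}^3_1$, $$\langle df,df\rangle=-\cos(2\omega_1)du^2-2\cos(\omega_1-\omega_2)dudv-\cos(2\omega_2)dv^2,\quad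 -\langle df,dN\rangle=2\sin(\omega_1+\omega_2)dudv,$$ $$\langle dN,dN\rangle=\cos(2\omega_1)du^2-2\cos(\omega_1-\omega_2)dudv+\cos(2\omega_2)dv^2.$$ *)

(* Defs.v *)
From Stdlib Require Import Reals Lra ZArith.
From Coquelicot Require Import Coquelicot.

Open Scope R_scope.

Record R42 : Type := mkR42 { q0 : R; q1 : R; q2 : R; q3 : R }.

Definition form42 (x y : R42) : R :=
  - (q0 x * q0 y) - q1 x * q1 y + q2 x * q2 y + q3 x * q3 y.

Definition qzero : R42 := mkR42 0 0 0 0.
Definition qone : R42 := mkR42 1 0 0 0.
Definition qi : R42 := mkR42 0 1 0 0.
Definition qj : R42 := mkR42 0 0 1 0.
Definition qk : R42 := mkR42 0 0 0 1.

(* Bilinear extension of i^2 = -1, j^2 = k^2 = 1, ij = k, ji = -k, ik = -j,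
   ki = j, jk = -i, kj = i; the table is checked in [qmul_table]. *)
Definition qmul (x y : R42) : R42 :=
  mkR42 (q0 x * q0 y - q1 x * q1 y + q2 x * q2 y + q3 x * q3 y)
        (q0 x * q1 y + q1 x * q0 y - q2 x * q3 y + q3 x * q2 y)
        (q0 x * q2 y + q2 x * q0 y - q1 x * q3 y + q3 x * q1 y)
        (q0 x * q3 y + q3 x * q0 y + q1 x * q2 y - q2 x * q1 y).

Definition qopp (x : R42) : R42 := mkR42 (- q0 x) (- q1 x) (- q2 x) (- q3 x).

Definition qconj (x : R42) : R42 := mkR42 (q0 x) (- q1 x) (- q2 x) (- q3 x).

Lemma R42_ext (x y : R42) :
  q0 x = q0 y -> q1 x = q1 y -> q2 x = q2 y -> q3 x = q3 y -> x = y.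
Proof. destruct x, y; simpl; intros; subst; reflexivity. Qed.

Lemma qmul_table :
  (qmul qi qi = qopp qone /\ qmul qj qj = qone /\ qmul qk qk = qone) /\
  (qmul qi qj = qk /\ qmul qj qi = qopp qk) /\
  (qmul qi qk = qopp qj /\ qmul qk qi = qj) /\
  (qmul qj qk = qopp qi /\ qmul qk qj = qi).
Proof. repeat split; apply R42_ext; simpl; ring. Qed.

Lemma qmul1l (x : R42) : qmul qone x = x.
Proof. apply R42_ext; simpl; ring. Qed.

Lemma qmul1r (x : R42) : qmul x qone = x.
Proof. apply R42_ext; simpl; ring. Qed.

Lemma qmulA (x y z : R42) : qmul x (qmul y z) = qmul (qmul x y) z.
Proof. apply R42_ext; simpl; ring. Qed.

Definition in_AdS (z : R42) : Prop := form42 z z = -1.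

Lemma in_AdS_conj (z : R42) : in_AdS z <-> qmul z (qconj z) = qone.
Proof.
unfold in_AdS, form42; split.
- intros H; apply R42_ext; simpl; lra.
- intros H; apply (f_equal q0) in H; simpl in H; lra.
Qed.

Definition smooth (h : R -> R) : Prop :=
  forall (n : nat) (t : R), ex_derive_n h n t.

Definition smooth_curve (a : R -> R42) : Prop :=
  smooth (fun s => q0 (a s)) /\ smooth (fun s => q1 (a s)) /\
  smooth (fun s => q2 (a s)) /\ smooth (fun s => q3 (a s)).

Definition velocity (a : R -> R42) (s : R) : R42 :=
  mkR42 (Derive (fun t => q0 (a t)) s) (Derive (fun t => q1 (a t)) s)
        (Derive (fun t => q2 (a t)) s) (Derive (fun t => q3 (a t)) s).

Definition regular_curve_in_AdS (a : R -> R42) : Prop :=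
  smooth_curve a /\ (forall s, in_AdS (a s)) /\
  (forall s, velocity a s <> qzero).

(* When <a', aj> = 0 one has conj(a) a' = lambda i + mu k, and lambda, mu are
   the second and fourth coordinates. *)
Definition asymptotic_parameter (a : R -> R42) : Prop :=
  forall s, q1 (qmul (qconj (a s)) (velocity a s)) ^ 2
          + q3 (qmul (qconj (a s)) (velocity a s)) ^ 2 = 1.

(* [w] is one of the functions omega^a, which are determined only up to a
   constant in 2 pi Z. *)
Definition angle_of (a : R -> R42) (w : R -> R) : Prop :=
  smooth w /\
  forall s, qmul (qconj (a s)) (velocity a s) = mkR42 0 (cos (w s)) 0 (sin (w s)).

Definition smooth2 (h : R * R -> R) : Prop :=
  forall (n : nat) (u v : R), ex_diff_n (fun x y => h (x, y)) n u v.

Definition differential (h : R * R -> R) (p X : R * R) : R :=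
  Derive (fun t => h (t, snd p)) (fst p) * fst X +
  Derive (fun t => h (fst p, t)) (snd p) * snd X.

Definition smooth_plane_map (F : R * R -> R * R) : Prop :=
  smooth2 (fun p => fst (F p)) /\ smooth2 (fun p => snd (F p)).

Definition plane_differential (F : R * R -> R * R) (p X : R * R) : R * R :=
  (differential (fun q => fst (F q)) p X, differential (fun q => snd (F q)) p X).

Definition global_diffeo (F : R * R -> R * R) : Prop :=
  smooth_plane_map F /\
  exists G : R * R -> R * R, smooth_plane_map G /\
    (forall p, G (F p) = p) /\ (forall p, F (G p) = p).

Definition smooth_surface (f : R * R -> R42) : Prop :=
  smooth2 (fun p => q0 (f p)) /\ smooth2 (fun p => q1 (f p)) /\
  smooth2 (fun p => q2 (f p)) /\ smooth2 (fun p => q3 (f p)).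

Definition surface_differential (f : R * R -> R42) (p X : R * R) : R42 :=
  mkR42 (differential (fun q => q0 (f q)) p X)
        (differential (fun q => q1 (f q)) p X)
        (differential (fun q => q2 (f q)) p X)
        (differential (fun q => q3 (f q)) p X).

Definition immersion_in_AdS (f : R * R -> R42) : Prop :=
  smooth_surface f /\ (forall p, in_AdS (f p)) /\
  (forall p X, surface_differential f p X = qzero -> X = (0, 0)).

Definition induced_metric (f : R * R -> R42) (p X Y : R * R) : R :=
  form42 (surface_differential f p X) (surface_differential f p Y).

Definition form_L2 (X Y : R * R) : R := - (fst X * fst Y) + snd X * snd Y.

Definition isometric_to_L2 (g : R * R -> R * R -> R * R -> R) : Prop :=
  exists Phi : R * R -> R * R, global_diffeo Phi /\
    forall p X Y,
      g p X Y = form_L2 (plane_differential Phi p X) (plane_differential Phi p Y).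

Definition isometric_immersion_of_L2 (f : R * R -> R42) : Prop :=
  immersion_in_AdS f /\ isometric_to_L2 (induced_metric f).

(* The symmetric bilinear form whose quadratic form is
   E du^2 + F du dv + G dv^2; note the halved cross term. *)
Definition sym_form (E F G : R) (X Y : R * R) : R :=
  E * (fst X * fst Y) + F * ((fst X * snd Y + snd X * fst Y) / 2)
  + G * (snd X * snd Y).

(* The value 1 is forced for surfaces of Lorentzian induced metric, since the
   tangent spaces of AdS have signature (-,+,+). *)
Definition unit_normal_in_AdS (f N : R * R -> R42) : Prop :=
  smooth_surface N /\
  forall p, form42 (N p) (N p) = 1 /\ form42 (N p) (f p) = 0 /\
    forall X, form42 (N p) (surface_differential f p X) = 0.

Definition global_characteristic_parameters
    (f : R * R -> R42) (w1 w2 : R -> R) : Prop :=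
  immersion_in_AdS f /\ smooth w1 /\ smooth w2 /\
  (forall u v, 0 < w1 u + w2 v < PI) /\
  exists N : R * R -> R42, unit_normal_in_AdS f N /\
    forall u v X Y,
      form42 (surface_differential f (u, v) X) (surface_differential f (u, v) Y)
        = sym_form (- cos (2 * w1 u)) (- 2 * cos (w1 u - w2 v))
            (- cos (2 * w2 v)) X Y /\
      - form42 (surface_differential f (u, v) X) (surface_differential N (u, v) Y)
        = sym_form 0 (2 * sin (w1 u + w2 v)) 0 X Y /\
      form42 (surface_differential N (u, v) X) (surface_differential N (u, v) Y)
        = sym_form (cos (2 * w1 u)) (- 2 * cos (w1 u - w2 v))
            (cos (2 * w2 v)) X Y.

(* Main.v *)
Require Import Defs.
From Stdlib Require Import Reals ZArith.
From Stdlib Require Import Lra Lia FunctionalExtensionality.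
From Coquelicot Require Import Coquelicot.
Open Scope R_scope.

(** The Leibniz rule and the structure equations [a1' = a1 xi1] and
    [a2' = a2 xi2], with [xi_i = cos wa_i i + sin wa_i k], give
    [f_u = a1 xi1 conj(a2)] and [f_v = a1 conj(xi2) conj(a2)].  The form is
    multiplicative, [<xy, xz> = - <x, x> <y, z>] and likewise on the right, so
    [z |-> a1 z conj(a2)] is an isometry for each [(u, v)]; hence the first
    fundamental form of [f] can be computed on the span of [i] and [k], and it
    is the pullback of the Lorentzian form of the plane under [(x, y)], whose
    partial derivatives [(cos w1, sin w1)] and [(cos w2, - sin w2)] are the
    components of [xi1] and [conj(xi2)] on [i] and [k].  This gives the isometry with
    the Lorentz plane ([product_surface_form], [isometric_to_L2_product_surface]), with
    [(x, y)] itself as the isometry.  Nondegeneracy of the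
    differential of [f] is [sin (w1 + w2) <> 0].

    The unit normal is [N = a1 j conj(a2)]: it is obtained from [j], which is
    orthogonal to [1], [i] and [k], by the same isometry.  It is itself a product
    of a function of [u] and a function of [v], so the second and third
    fundamental forms come from the same computation.

    Finally [sin (w1 + w2) > 0] on the connected plane confines [w1 + w2] to one
    interval [(2 m pi, 2 m pi + pi)] ([sum_in_half_period]), which is moved to
    [(0, pi)] by a translation of [w1]. *)

(** * Smooth functions of one and two variables *)

Lemma smooth_ex_derive (h : R -> R) :
  smooth h -> forall t, ex_derive h t.
Proof. intros H t; exact (H 1%nat t). Qed.

Lemma smooth_Derive (h : R -> R) : smooth h -> smooth (Derive h).
Proof.
intros H [|n] t; [exact I|].
generalize (H (S (S n)) t); simpl; apply ex_derive_ext; intros s.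
change (Derive (Derive_n h n) s) with (Derive_n h (S n) s).
rewrite <- (Nat.add_1_r n); exact (eq_sym (Derive_n_comp h n 1 s)).
Qed.

Lemma smooth_plus (g h : R -> R) :
  smooth g -> smooth h -> smooth (fun t => g t + h t).
Proof.
intros Hg Hh n t; apply ex_derive_n_plus;
  apply filter_forall; intros s k _; [apply Hg | apply Hh].
Qed.

Lemma smooth_minus (g h : R -> R) :
  smooth g -> smooth h -> smooth (fun t => g t - h t).
Proof.
intros Hg Hh n t; apply ex_derive_n_minus;
  apply filter_forall; intros s k _; [apply Hg | apply Hh].
Qed.

Lemma smooth_scal_l (c : R) (h : R -> R) :
  smooth h -> smooth (fun t => c * h t).
Proof. intros H n t; apply ex_derive_n_scal_l, H. Qed.

Lemma smooth_opp (h : R -> R) : smooth h -> smooth (fun t => - h t).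
Proof. intros H n t; apply ex_derive_n_opp, H. Qed.

Lemma smooth_const (c : R) : smooth (fun _ => c).
Proof. intros [|n] t; [exact I | apply ex_derive_n_const]. Qed.

Lemma ex_diff_n_plus (n : nat) : forall f g : R -> R -> R,
  (forall u v, ex_diff_n f n u v) -> (forall u v, ex_diff_n g n u v) ->
  forall u v, ex_diff_n (fun x y => f x y + g x y) n u v.
Proof.
induction n as [|n IH]; intros f g Hf Hg u v.
- split; [|exact I]; apply continuity_2d_pt_plus; [apply Hf | apply Hg].
- assert (Hf1 := fun u v => proj1 (proj2 (Hf u v))).
  assert (Hg1 := fun u v => proj1 (proj2 (Hg u v))).
  assert (Hf2 := fun u v => proj1 (proj2 (proj2 (Hf u v)))).
  assert (Hg2 := fun u v => proj1 (proj2 (proj2 (Hg u v)))).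
  split; [apply continuity_2d_pt_plus; [apply Hf | apply Hg]|].
  split; [apply @ex_derive_plus; [apply Hf1 | apply Hg1]|].
  split; [apply @ex_derive_plus; [apply Hf2 | apply Hg2]|].
  split.
  + replace (fun u v => Derive (fun z => f z v + g z v) u)
      with (fun u v => Derive (fun z => f z v) u + Derive (fun z => g z v) u).
    * apply IH; intros x y; [apply Hf | apply Hg].
    * extensionality x; extensionality y; symmetry.
      apply Derive_plus; [apply Hf1 | apply Hg1].
  + replace (fun u v => Derive (fun z => f u z + g u z) v)
      with (fun u v => Derive (fun z => f u z) v + Derive (fun z => g u z) v).
    * apply IH; intros x y; [apply Hf | apply Hg].
    * extensionality x; extensionality y; symmetry.
      apply Derive_plus; [apply Hf2 | apply Hg2].
Qed.

Lemma smooth_continuity_pt (h : R -> R) (t : R) : smooth h -> continuity_pt h t.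
Proof.
intros H; apply continuity_pt_filterlim.
exact (ex_derive_continuous h t (smooth_ex_derive h H t)).
Qed.

Lemma continuity_2d_pt_separated (h k : R -> R) (u v : R) :
  smooth h -> smooth k -> continuity_2d_pt (fun x y => h x * k y) u v.
Proof.
intros Hh Hk; apply continuity_2d_pt_mult.
- apply (continuity_1d_2d_pt_comp h (fun x _ => x));
    [apply smooth_continuity_pt, Hh | apply continuity_2d_pt_id1].
- apply (continuity_1d_2d_pt_comp k (fun _ y => y));
    [apply smooth_continuity_pt, Hk | apply continuity_2d_pt_id2].
Qed.

Lemma ex_diff_n_separated (n : nat) : forall h k : R -> R,
  smooth h -> smooth k ->
  forall u v, ex_diff_n (fun x y => h x * k y) n u v.
Proof.
induction n as [|n IH]; intros h k Hh Hk u v.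
- split; [now apply continuity_2d_pt_separated | exact I].
- split; [now apply continuity_2d_pt_separated|].
  assert (Dh := smooth_ex_derive h Hh); assert (Dk := smooth_ex_derive k Hk).
  split; [auto_derive; auto|].
  split; [auto_derive; auto|].
  split.
  + replace (fun u v => Derive (fun z => h z * k v) u)
      with (fun u v => Derive h u * k v).
    * apply IH; [apply smooth_Derive, Hh | exact Hk].
    * extensionality x; extensionality y; symmetry; apply Derive_scal_l.
  + replace (fun u v => Derive (fun z => h u * k z) v)
      with (fun u v => h u * Derive k v).
    * apply IH; [exact Hh | apply smooth_Derive, Hk].
    * extensionality x; extensionality y; symmetry; apply Derive_scal.
Qed.

Lemma smooth2_separated (h k : R -> R) :
  smooth h -> smooth k -> smooth2 (fun p => h (fst p) * k (snd p)).
Proof. intros Hh Hk n u v; exact (ex_diff_n_separated n h k Hh Hk u v). Qed.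

Lemma smooth2_plus (F G : R * R -> R) :
  smooth2 F -> smooth2 G -> smooth2 (fun p => F p + G p).
Proof.
intros HF HG n u v.
exact (ex_diff_n_plus n (fun x y => F (x, y)) (fun x y => G (x, y))
         (HF n) (HG n) u v).
Qed.

Lemma smooth2_minus_separated (F : R * R -> R) (h k : R -> R) :
  smooth2 F -> smooth h -> smooth k ->
  smooth2 (fun p => F p - h (fst p) * k (snd p)).
Proof.
intros HF Hh Hk.
replace (fun p : R * R => F p - h (fst p) * k (snd p))
  with (fun p : R * R => F p + - h (fst p) * k (snd p))
  by (extensionality p; ring).
apply (smooth2_plus F (fun p => - h (fst p) * k (snd p))); [exact HF|].
apply (smooth2_separated (fun t => - h t) k); [apply smooth_opp, Hh | exact Hk].
Qed.

(** * The algebra of R^4_2 *)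

Definition qplus (x y : R42) : R42 :=
  mkR42 (q0 x + q0 y) (q1 x + q1 y) (q2 x + q2 y) (q3 x + q3 y).

Definition qscal (c : R) (x : R42) : R42 :=
  mkR42 (c * q0 x) (c * q1 x) (c * q2 x) (c * q3 x).

Lemma form42_qmul_l (a x y : R42) :
  form42 (qmul a x) (qmul a y) = - form42 a a * form42 x y.
Proof. unfold form42; simpl; ring. Qed.

Lemma form42_qmul_r (b x y : R42) :
  form42 (qmul x b) (qmul y b) = - form42 b b * form42 x y.
Proof. unfold form42; simpl; ring. Qed.

Lemma qconj_qmul (x y : R42) : qconj (qmul x y) = qmul (qconj y) (qconj x).
Proof. apply R42_ext; simpl; ring. Qed.

Lemma in_AdS_qconj (z : R42) : in_AdS z -> in_AdS (qconj z).
Proof. unfold in_AdS, form42; simpl; lra. Qed.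

(** Unit elements act by isometries on both sides. *)
Lemma form42_sandwich (a b x y : R42) :
  in_AdS a -> in_AdS b ->
  form42 (qmul a (qmul x b)) (qmul a (qmul y b)) = form42 x y.
Proof.
unfold in_AdS; intros Ha Hb.
rewrite form42_qmul_l, form42_qmul_r, Ha, Hb; ring.
Qed.

(** * Curves and product surfaces *)

Lemma smooth_curve_qmul_l (c : R42) (b : R -> R42) :
  smooth_curve b -> smooth_curve (fun t => qmul c (b t)).
Proof.
intros (H0 & H1 & H2 & H3).
split; [|split; [|split]]; simpl;
repeat match goal with
| |- smooth (fun t => _ + _) => apply smooth_plus
| |- smooth (fun t => _ - _) => apply smooth_minus
| |- smooth (fun t => _ * _) => apply smooth_scal_l
end; assumption.
Qed.

Lemma smooth_curve_qconj (b : R -> R42) :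
  smooth_curve b -> smooth_curve (fun t => qconj (b t)).
Proof.
intros (H0 & H1 & H2 & H3).
split; [exact H0|].
split; [|split]; simpl; apply smooth_opp; assumption.
Qed.

(** A curve may be assumed to be given by its four coordinate functions. *)
Lemma curve_coordinates (P : (R -> R42) -> Prop) :
  (forall b0 b1 b2 b3 : R -> R, P (fun t => mkR42 (b0 t) (b1 t) (b2 t) (b3 t))) ->
  forall b, P b.
Proof.
intros H b.
replace b with (fun t => mkR42 (q0 (b t)) (q1 (b t)) (q2 (b t)) (q3 (b t))).
- exact (H (fun t => q0 (b t)) (fun t => q1 (b t))
           (fun t => q2 (b t)) (fun t => q3 (b t))).
- extensionality t; destruct (b t); reflexivity.
Qed.

Lemma velocity_qmul_l (c : R42) (b : R -> R42) (s : R) :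
  smooth_curve b -> velocity (fun t => qmul c (b t)) s = qmul c (velocity b s).
Proof.
pattern b; apply curve_coordinates; clear b; intros b0 b1 b2 b3 (H0 & H1 & H2 & H3).
apply smooth_ex_derive with (t := s) in H0, H1, H2, H3; simpl in H0, H1, H2, H3.
apply R42_ext; simpl; apply is_derive_unique;
auto_derive; auto; simpl; ring.
Qed.

Lemma velocity_qmul_r (c : R42) (b : R -> R42) (s : R) :
  smooth_curve b -> velocity (fun t => qmul (b t) c) s = qmul (velocity b s) c.
Proof.
pattern b; apply curve_coordinates; clear b; intros b0 b1 b2 b3 (H0 & H1 & H2 & H3).
apply smooth_ex_derive with (t := s) in H0, H1, H2, H3; simpl in H0, H1, H2, H3.
apply R42_ext; simpl; apply is_derive_unique;
auto_derive; auto; simpl; ring.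
Qed.

Lemma velocity_qconj (b : R -> R42) (s : R) :
  velocity (fun t => qconj (b t)) s = qconj (velocity b s).
Proof. apply R42_ext; simpl; try reflexivity; apply Derive_opp. Qed.

(** In the left-invariant frame, the velocity of a curve in the group [H^3_1]
    is recovered from its logarithmic derivative. *)
Lemma velocity_of_log_derivative (a : R -> R42) (s : R) (xi : R42) :
  in_AdS (a s) -> qmul (qconj (a s)) (velocity a s) = xi ->
  velocity a s = qmul (a s) xi.
Proof.
intros Ha <-.
now rewrite qmulA, (proj1 (in_AdS_conj _) Ha), qmul1l.
Qed.

Lemma smooth_surface_qmul (a b : R -> R42) :
  smooth_curve a -> smooth_curve b ->
  smooth_surface (fun p => qmul (a (fst p)) (b (snd p))).
Proof.
pattern a; apply curve_coordinates; clear a; intros a0 a1 a2 a3 (A0 & A1 & A2 & A3).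
pattern b; apply curve_coordinates; clear b; intros b0 b1 b2 b3 (B0 & B1 & B2 & B3).
cbn [q0 q1 q2 q3] in *.
assert (S : forall h k, smooth h -> smooth k ->
          smooth2 (fun p => h (fst p) * k (snd p))) by apply smooth2_separated.
assert (M := smooth2_minus_separated).
split; [|split; [|split]]; cbn [q0 q1 q2 q3 qmul].
- apply (smooth2_plus _ (fun p => a3 (fst p) * b3 (snd p))); [|auto].
  apply (smooth2_plus _ (fun p => a2 (fst p) * b2 (snd p))); [|auto].
  apply (M (fun p => a0 (fst p) * b0 (snd p)) a1 b1); auto.
- apply (smooth2_plus _ (fun p => a3 (fst p) * b2 (snd p))); [|auto].
  apply (M (fun p => a0 (fst p) * b1 (snd p) + a1 (fst p) * b0 (snd p)) a2 b3);
    auto.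
  apply (smooth2_plus (fun p => a0 (fst p) * b1 (snd p))
                      (fun p => a1 (fst p) * b0 (snd p))); auto.
- apply (smooth2_plus _ (fun p => a3 (fst p) * b1 (snd p))); [|auto].
  apply (M (fun p => a0 (fst p) * b2 (snd p) + a2 (fst p) * b0 (snd p)) a1 b3);
    auto.
  apply (smooth2_plus (fun p => a0 (fst p) * b2 (snd p))
                      (fun p => a2 (fst p) * b0 (snd p))); auto.
- apply (M (fun p => a0 (fst p) * b3 (snd p) + a3 (fst p) * b0 (snd p)
                     + a1 (fst p) * b2 (snd p)) a2 b1); auto.
  apply (smooth2_plus _ (fun p => a1 (fst p) * b2 (snd p))); [|auto].
  apply (smooth2_plus (fun p => a0 (fst p) * b3 (snd p))
                      (fun p => a3 (fst p) * b0 (snd p))); auto.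
Qed.

Lemma surface_differential_qmul (a b : R -> R42) (p X : R * R) :
  smooth_curve a -> smooth_curve b ->
  surface_differential (fun p => qmul (a (fst p)) (b (snd p))) p X =
  qplus (qscal (fst X) (qmul (velocity a (fst p)) (b (snd p))))
        (qscal (snd X) (qmul (a (fst p)) (velocity b (snd p)))).
Proof.
intros Ha Hb.
rewrite <- (velocity_qmul_r (b (snd p)) a (fst p) Ha).
rewrite <- (velocity_qmul_l (a (fst p)) b (snd p) Hb).
unfold surface_differential, Defs.differential, velocity, qplus, qscal.
apply R42_ext; cbn [q0 q1 q2 q3 fst snd]; ring.
Qed.

(** * The fundamental forms of a product of two asymptotic curves *)

(** The surface [(u, v) |-> a1(u) c conj(a2(v))]: the immersion of the theorem
    for [c = 1], and its unit normal for [c = j]. *)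
Definition product_surface (a1 a2 : R -> R42) (c : R42) (p : R * R) : R42 :=
  qmul (a1 (fst p)) (qmul c (qconj (a2 (snd p)))).

(** A curve in [H^3_1] in asymptotic parametrization, with angle function [w]:
    [a' = a (cos w i + sin w k)]. *)
Definition asymptotic_curve (a : R -> R42) (w : R -> R) : Prop :=
  smooth_curve a /\ (forall s, in_AdS (a s)) /\
  forall s, velocity a s = qmul (a s) (mkR42 0 (cos (w s)) 0 (sin (w s))).

(** The differential at [p] of [product_surface a1 a2 c], for curves with angle
    functions [w1] and [pi - w2], after the factors [a1(u)] on the left and
    [conj(a2(v))] on the right are removed. *)
Definition frame_differential (w1 w2 : R -> R) (c : R42) (p X : R * R) : R42 :=
  qplus (qscal (fst X)
           (qmul (mkR42 0 (cos (w1 (fst p))) 0 (sin (w1 (fst p)))) c))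
        (qscal (snd X)
           (qmul c (mkR42 0 (cos (w2 (snd p))) 0 (- sin (w2 (snd p)))))).

Lemma smooth_product_surface (a1 a2 : R -> R42) (c : R42) :
  smooth_curve a1 -> smooth_curve a2 -> smooth_surface (product_surface a1 a2 c).
Proof.
intros S1 S2.
apply (smooth_surface_qmul a1 (fun v => qmul c (qconj (a2 v)))); [assumption|].
apply (smooth_curve_qmul_l c (fun v => qconj (a2 v))).
now apply smooth_curve_qconj.
Qed.

Lemma product_surface_differential (a1 a2 : R -> R42) (w1 w2 : R -> R)
    (c : R42) (p X : R * R) :
  asymptotic_curve a1 w1 -> asymptotic_curve a2 (fun v => PI - w2 v) ->
  surface_differential (product_surface a1 a2 c) p X =
  qmul (a1 (fst p))
       (qmul (frame_differential w1 w2 c p X) (qconj (a2 (snd p)))).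
Proof.
intros (S1 & _ & V1) (S2 & _ & V2).
pose proof (smooth_curve_qconj a2 S2) as S2c.
unfold product_surface.
rewrite (surface_differential_qmul a1 (fun v => qmul c (qconj (a2 v))));
  [|assumption | now apply (smooth_curve_qmul_l c (fun v => qconj (a2 v)))].
rewrite (velocity_qmul_l c (fun v => qconj (a2 v))), velocity_qconj by assumption.
rewrite V1, V2, qconj_qmul, cos_minus, sin_minus, cos_PI, sin_PI.
unfold frame_differential.
generalize (a1 (fst p)) (qconj (a2 (snd p))); intros x y.
apply R42_ext; simpl; ring.
Qed.

Lemma product_surface_form (a1 a2 : R -> R42) (w1 w2 : R -> R)
    (c d : R42) (p X Y : R * R) :
  asymptotic_curve a1 w1 -> asymptotic_curve a2 (fun v => PI - w2 v) ->
  form42 (surface_differential (product_surface a1 a2 c) p X)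
         (surface_differential (product_surface a1 a2 d) p Y) =
  form42 (frame_differential w1 w2 c p X) (frame_differential w1 w2 d p Y).
Proof.
intros H1 H2.
rewrite !(product_surface_differential a1 a2 w1 w2) by assumption.
apply form42_sandwich; [|apply in_AdS_qconj]; [apply H1 | apply H2].
Qed.

Lemma product_surface_form_value (a1 a2 : R -> R42) (c d : R42) (p : R * R) :
  (forall u, in_AdS (a1 u)) -> (forall v, in_AdS (a2 v)) ->
  form42 (product_surface a1 a2 c p) (product_surface a1 a2 d p) = form42 c d.
Proof.
intros H1 H2; apply form42_sandwich; [apply H1 | apply in_AdS_qconj, H2].
Qed.

Lemma product_surface_immersion (a1 a2 : R -> R42) (w1 w2 : R -> R) :
  asymptotic_curve a1 w1 -> asymptotic_curve a2 (fun v => PI - w2 v) ->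
  (forall u v, sin (w1 u + w2 v) <> 0) ->
  immersion_in_AdS (product_surface a1 a2 qone).
Proof.
intros H1 H2 Hsin.
split; [apply smooth_product_surface; [apply H1 | apply H2]|].
split.
{ intros p; unfold in_AdS.
  rewrite product_surface_form_value; [|apply H1 | apply H2].
  unfold form42; simpl; ring. }
intros p X HX.
rewrite (product_surface_differential a1 a2 w1 w2) in HX by assumption.
assert (H : frame_differential w1 w2 qone p X = qzero).
{ set (z := frame_differential w1 w2 qone p X) in *.
  assert (E : qmul (qconj (a1 (fst p)))
     (qmul (qmul (a1 (fst p)) (qmul z (qconj (a2 (snd p))))) (a2 (snd p))) = z).
  { assert (C1 := proj1 (in_AdS_conj _)
                    (in_AdS_qconj _ (proj1 (proj2 H1) (fst p)))).
    assert (C2 := proj1 (in_AdS_conj _)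
                    (in_AdS_qconj _ (proj1 (proj2 H2) (snd p)))).
    assert (K : forall y, qconj (qconj y) = y)
      by (intros y; apply R42_ext; simpl; ring).
    rewrite K in C1, C2.
    now rewrite !qmulA, C1, qmul1l, <- qmulA, C2, qmul1r. }
  rewrite HX in E; rewrite <- E; apply R42_ext; simpl; ring. }
assert (Hi := f_equal q1 H); assert (Hk := f_equal q3 H); clear H HX.
specialize (Hsin (fst p) (snd p)).
destruct X as [x y]; simpl in Hi, Hk.
ring_simplify in Hi; ring_simplify in Hk.
(* Cramer's rule: the determinant of the system is [- sin (w1 + w2)] *)
f_equal; apply (Rmult_eq_reg_l _ _ _) with (2 := Hsin); rewrite sin_plus.
- replace ((sin (w1 (fst p)) * cos (w2 (snd p))
            + cos (w1 (fst p)) * sin (w2 (snd p))) * x)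
    with (cos (w2 (snd p)) * (x * sin (w1 (fst p)) - y * sin (w2 (snd p)))
          + sin (w2 (snd p)) * (x * cos (w1 (fst p)) + y * cos (w2 (snd p))))
    by ring.
  rewrite Hi, Hk; ring.
- replace ((sin (w1 (fst p)) * cos (w2 (snd p))
            + cos (w1 (fst p)) * sin (w2 (snd p))) * y)
    with (sin (w1 (fst p)) * (x * cos (w1 (fst p)) + y * cos (w2 (snd p)))
          - cos (w1 (fst p)) * (x * sin (w1 (fst p)) - y * sin (w2 (snd p))))
    by ring.
  rewrite Hi, Hk; ring.
Qed.

Lemma product_surface_unit_normal (a1 a2 : R -> R42) (w1 w2 : R -> R) :
  asymptotic_curve a1 w1 -> asymptotic_curve a2 (fun v => PI - w2 v) ->
  unit_normal_in_AdS (product_surface a1 a2 qone) (product_surface a1 a2 qj).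
Proof.
intros H1 H2.
split; [apply smooth_product_surface; [apply H1 | apply H2]|].
intros p.
rewrite !product_surface_form_value by (apply H1 || apply H2).
split; [unfold form42; simpl; ring|].
split; [unfold form42; simpl; ring|].
intros X; rewrite (product_surface_differential a1 a2 w1 w2) by assumption.
unfold product_surface; rewrite form42_sandwich;
  [|apply H1 | apply in_AdS_qconj, H2].
unfold form42; simpl; ring.
Qed.

Lemma product_surface_characteristic (a1 a2 : R -> R42) (w1 w2 : R -> R) :
  asymptotic_curve a1 w1 -> asymptotic_curve a2 (fun v => PI - w2 v) ->
  smooth w1 -> smooth w2 -> (forall u v, 0 < w1 u + w2 v < PI) ->
  global_characteristic_parameters (product_surface a1 a2 qone) w1 w2.
Proof.
intros H1 H2 S1 S2 Hw.
split.
{ apply (product_surface_immersion a1 a2 w1 w2); auto.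
  intros u v; apply Rgt_not_eq, sin_gt_0; apply Hw. }
do 3 (split; [assumption|]).
exists (product_surface a1 a2 qj).
split; [now apply (product_surface_unit_normal a1 a2 w1 w2)|].
intros u v X Y.
rewrite !(product_surface_form a1 a2 w1 w2) by assumption.
rewrite !cos_2a, cos_minus, sin_plus.
unfold form42, sym_form; simpl.
repeat split; field.
Qed.

(** * The isometry with the Lorentz plane *)

Lemma is_derive_RInt_0 (h : R -> R) (t : R) :
  (forall s, continuous h s) -> is_derive (fun s => RInt h 0 s) t (h t).
Proof.
intros H.
apply (@is_derive_RInt _ h (fun s => RInt h 0 s) 0 t); [|apply H].
apply filter_forall; intros s; apply (@RInt_correct R_CompleteNormedModule h 0 s);
  apply (@ex_RInt_continuous R_CompleteNormedModule); auto.
Qed.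

Lemma differential_separated_RInt (h k : R -> R) (p X : R * R) :
  (forall t, continuous h t) -> (forall t, continuous k t) ->
  Defs.differential (fun q => RInt h 0 (fst q) + RInt k 0 (snd q)) p X =
  h (fst p) * fst X + k (snd p) * snd X.
Proof.
intros Hh Hk; unfold Defs.differential; cbn [fst snd]; f_equal; f_equal;
  apply is_derive_unique.
- rewrite <- (Rplus_0_r (h (fst p))).
  apply (@is_derive_plus _ _ (fun t => RInt h 0 t) (fun _ => RInt k 0 (snd p)));
    [now apply is_derive_RInt_0 | exact (is_derive_const _ _)].
- rewrite <- (Rplus_0_l (k (snd p))).
  apply (@is_derive_plus _ _ (fun _ => RInt h 0 (fst p)) (fun t => RInt k 0 t));
    [exact (is_derive_const _ _) | now apply is_derive_RInt_0].
Qed.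

Lemma continuous_comp_smooth (g w : R -> R) (t : R) :
  (forall s, continuous g s) -> smooth w -> continuous (fun s => g (w s)) t.
Proof.
intros Hg Hw; apply continuous_comp; [|apply Hg].
exact (ex_derive_continuous w t (smooth_ex_derive w Hw t)).
Qed.

(** The coordinates [(x, y)] on the plane in which the induced metric is
    [- dx^2 + dy^2]. *)
Definition flat_coordinates (w1 w2 : R -> R) (p : R * R) : R * R :=
  (RInt (fun t => cos (w1 t)) 0 (fst p) + RInt (fun t => cos (w2 t)) 0 (snd p),
   RInt (fun t => sin (w1 t)) 0 (fst p) - RInt (fun t => sin (w2 t)) 0 (snd p)).

Lemma flat_coordinates_differential (w1 w2 : R -> R) (p X : R * R) :
  smooth w1 -> smooth w2 ->
  plane_differential (flat_coordinates w1 w2) p X =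
  (cos (w1 (fst p)) * fst X + cos (w2 (snd p)) * snd X,
   sin (w1 (fst p)) * fst X - sin (w2 (snd p)) * snd X).
Proof.
intros S1 S2.
assert (C : forall w, smooth w -> forall t, continuous (fun s => cos (w s)) t)
  by (intros w Hw t; apply continuous_comp_smooth; [apply continuous_cos | auto]).
assert (S : forall w, smooth w -> forall t, continuous (fun s => sin (w s)) t)
  by (intros w Hw t; apply continuous_comp_smooth; [apply continuous_sin | auto]).
unfold plane_differential, flat_coordinates; cbn [fst snd]; f_equal.
- apply (differential_separated_RInt (fun t => cos (w1 t)) (fun t => cos (w2 t)));
    auto.
- replace (fun q : R * R => RInt (fun t => sin (w1 t)) 0 (fst q)
                            - RInt (fun t => sin (w2 t)) 0 (snd q))
    with (fun q : R * R => RInt (fun t => sin (w1 t)) 0 (fst q)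
                           + RInt (fun t => - sin (w2 t)) 0 (snd q)).
  + rewrite (differential_separated_RInt (fun t => sin (w1 t))
               (fun t => - sin (w2 t))); auto.
    * ring.
    * intros t; apply (continuous_opp (fun s => sin (w2 s))); auto.
  + extensionality q; unfold Rminus; f_equal.
    apply (RInt_opp (fun t => sin (w2 t))), ex_RInt_continuous; auto.
Qed.

Lemma isometric_to_L2_product_surface (a1 a2 : R -> R42) (w1 w2 : R -> R) :
  asymptotic_curve a1 w1 -> asymptotic_curve a2 (fun v => PI - w2 v) ->
  smooth w1 -> smooth w2 -> global_diffeo (flat_coordinates w1 w2) ->
  isometric_to_L2 (induced_metric (product_surface a1 a2 qone)).
Proof.
intros H1 H2 S1 S2 HF.
exists (flat_coordinates w1 w2); split; [exact HF|].
intros p X Y; unfold induced_metric.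
rewrite (product_surface_form a1 a2 w1 w2) by assumption.
rewrite !flat_coordinates_differential by assumption.
unfold form42, form_L2; simpl; ring.
Qed.

(** * Normalization of the angle functions *)

Lemma cos_sin_period_Z (x : R) (m : Z) :
  cos (x + 2 * PI * IZR m) = cos x /\ sin (x + 2 * PI * IZR m) = sin x.
Proof.
destruct (Z_le_gt_dec 0 m) as [Hm | Hm].
- rewrite <- (Z2Nat.id m Hm), <- INR_IZR_INZ; set (k := Z.to_nat m).
  replace (x + 2 * PI * INR k) with (x + 2 * INR k * PI) by ring.
  split; [apply cos_period | apply sin_period].
- assert (E : IZR m = - INR (Z.to_nat (- m))).
  { rewrite INR_IZR_INZ, Z2Nat.id, opp_IZR by lia; ring. }
  rewrite E; set (k := Z.to_nat (- m)).
  rewrite <- (cos_period (x + _) k), <- (sin_period (x + _) k).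
  replace (x + 2 * PI * - INR k + 2 * INR k * PI) with x by ring; auto.
Qed.

Lemma positive_sin_half_period (x : R) :
  sin x > 0 -> exists m : Z, 0 < x + 2 * PI * IZR m < PI.
Proof.
intros Hx.
assert (P := PI_RGT_0).
set (n := Int_part (x / (2 * PI))); exists (- n)%Z.
destruct (base_Int_part (x / (2 * PI))) as [L U]; fold n in L, U.
set (y := x + 2 * PI * IZR (- n)).
assert (Ey : y = 2 * PI * (x / (2 * PI) - IZR n))
  by (unfold y; rewrite opp_IZR; field; lra).
assert (Sy : sin y > 0) by (unfold y; rewrite (proj2 (cos_sin_period_Z _ _)); auto).
assert (Y0 : 0 <= y) by (rewrite Ey; apply Rmult_le_pos; lra).
assert (Y1 : y < 2 * PI).
{ rewrite Ey; apply Rlt_le_trans with (2 * PI * 1); [|lra].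
  apply Rmult_lt_compat_l; lra. }
split.
- destruct Y0 as [Y0 | Y0]; [exact Y0 | rewrite <- Y0, sin_0 in Sy; lra].
- destruct (Rlt_or_le y PI) as [H | H]; [exact H|].
  assert (sin y <= 0) by (apply sin_le_0; lra); lra.
Qed.

Lemma continuous_positive_sin (g : R -> R) :
  continuity g -> (forall t, sin (g t) > 0) -> 0 < g 0 < PI -> 0 < g 1 < PI.
Proof.
intros Hg Hs H0.
split; apply Rnot_le_lt; intros H1.
- destruct (IVT_gen g 0 1 0 Hg) as [t [_ Ht]].
  + rewrite Rmin_right, Rmax_left; lra.
  + specialize (Hs t); rewrite Ht, sin_0 in Hs; lra.
- destruct (IVT_gen g 0 1 PI Hg) as [t [_ Ht]].
  + rewrite Rmin_left, Rmax_right; lra.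
  + specialize (Hs t); rewrite Ht, sin_PI in Hs; lra.
Qed.

(** Along the segment from [(0, 0)] to [(u, v)], the sum [w1 + w2] cannot leave
    the interval between two consecutive zeros of [sin]. *)
Lemma sum_in_half_period (w1 w2 : R -> R) :
  smooth w1 -> smooth w2 -> (forall u v, sin (w1 u + w2 v) > 0) ->
  exists m : Z, forall u v, 0 < w1 u + 2 * PI * IZR m + w2 v < PI.
Proof.
intros S1 S2 Hs.
destruct (positive_sin_half_period _ (Hs 0 0)) as [m Hm]; exists m; intros u v.
assert (H := continuous_positive_sin
  (fun t => w1 (t * u) + w2 (t * v) + 2 * PI * IZR m)); cbv beta in H.
rewrite !Rmult_0_l, !Rmult_1_l in H.
replace (w1 u + 2 * PI * IZR m + w2 v) with (w1 u + w2 v + 2 * PI * IZR m) by ring.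
apply H; [|intros t; rewrite (proj2 (cos_sin_period_Z _ m)); apply Hs | exact Hm].
intros t; apply derivable_continuous_pt, ex_derive_Reals_0.
auto_derive; repeat split; apply smooth_ex_derive; assumption.
Qed.

Lemma asymptotic_curve_of_angle (a : R -> R42) (w : R -> R) :
  regular_curve_in_AdS a -> angle_of a w -> asymptotic_curve a w.
Proof.
intros (Sa & Ha & _) (_ & E).
split; [exact Sa|]; split; [exact Ha|].
intros s; apply velocity_of_log_derivative; auto.
Qed.

Lemma asymptotic_curve_eq_angle (a : R -> R42) (w w' : R -> R) :
  (forall s, cos (w' s) = cos (w s) /\ sin (w' s) = sin (w s)) ->
  asymptotic_curve a w -> asymptotic_curve a w'.
Proof.
intros E (Sa & Ha & V).
split; [exact Sa|]; split; [exact Ha|].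
intros s; rewrite (proj1 (E s)), (proj2 (E s)); apply V.
Qed.

Theorem theorem11 :
  forall (a1 a2 : R -> R42) (wa1 wa2 : R -> R),
    regular_curve_in_AdS a1 ->
    regular_curve_in_AdS a2 ->
    a1 0 = qone ->
    a2 0 = qone ->
    (forall u, form42 (velocity a1 u) (qmul (a1 u) qj) = 0) ->
    (forall v, form42 (velocity a2 v) (qmul (a2 v) qj) = 0) ->
    asymptotic_parameter a1 ->
    asymptotic_parameter a2 ->
    angle_of a1 wa1 ->
    angle_of a2 wa2 ->
    let w1 := wa1 in
    let w2 := fun v => PI - wa2 v in
    (forall u v, sin (w1 u + w2 v) > 0) ->
    global_diffeo (fun p : R * R =>
      (RInt (fun t => cos (w1 t)) 0 (fst p) + RInt (fun t => cos (w2 t)) 0 (snd p),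
       RInt (fun t => sin (w1 t)) 0 (fst p) - RInt (fun t => sin (w2 t)) 0 (snd p))) ->
    let f := fun p : R * R => qmul (a1 (fst p)) (qconj (a2 (snd p))) in
    isometric_immersion_of_L2 f /\
    exists m1 m2 : Z,
      global_characteristic_parameters f
        (fun u => w1 u + 2 * PI * IZR m1)
        (fun v => w2 v + 2 * PI * IZR m2).
Proof.
intros a1 a2 wa1 wa2 R1 R2 _ _ _ _ _ _ A1 A2 w1 w2 Hsin HF f.
assert (H1 : asymptotic_curve a1 w1) by now apply asymptotic_curve_of_angle.
assert (H2 : asymptotic_curve a2 (fun v => PI - w2 v)).
{ apply (asymptotic_curve_eq_angle a2 wa2);
    [|now apply asymptotic_curve_of_angle].
  intros s; unfold w2.
  replace (PI - (PI - wa2 s)) with (wa2 s) by ring; auto. }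
assert (S1 : smooth w1) by apply A1.
assert (S2 : smooth w2).
{ apply (smooth_minus (fun _ => PI) wa2); [apply smooth_const | apply A2]. }
assert (Ef : f = product_surface a1 a2 qone).
{ extensionality p; unfold f, product_surface; now rewrite qmul1l. }
clearbody f w1 w2; subst f; split.
- split.
  + apply (product_surface_immersion a1 a2 w1 w2); auto.
    intros u v; apply Rgt_not_eq, Hsin.
  + now apply (isometric_to_L2_product_surface a1 a2 w1 w2).
- destruct (sum_in_half_period w1 w2 S1 S2 Hsin) as [m Hm].
  exists m, 0%Z.
  apply product_surface_characteristic.
  + apply (asymptotic_curve_eq_angle a1 w1); [|exact H1].
    intros s; apply cos_sin_period_Z.
  + apply (asymptotic_curve_eq_angle a2 (fun v => PI - w2 v)); [|exact H2].
    intros s; replace (PI - (w2 s + 2 * PI * 0)) with (PI - w2 s) by ring; auto.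
  + apply (smooth_plus w1 (fun _ => 2 * PI * IZR m));
      [exact S1 | apply smooth_const].
  + apply (smooth_plus w2 (fun _ => 2 * PI * 0));
      [exact S2 | apply smooth_const].
  + intros u v.
    replace (w1 u + 2 * PI * IZR m + (w2 v + 2 * PI * 0))
      with (w1 u + 2 * PI * IZR m + w2 v) by ring; apply Hm.
Qed.
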